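(* Let $d\ge 3$ and let $f(x,y)=\ell_0(x,y)^{d-2}\ell_1(x,y)\ell_2(x,y)$, where $\ell_0,\ell_1,\ell_2\in\mathbb{C}[x,y]$ are distinct (i.e. pairwise non-proportional) nonzero binary linear forms. Then $L_{\mathbb{C}}(f)=d-1$.
   Context: For a field $K\subseteq\mathbb{C}$ and a binary form (homogeneous polynomial in $x,y$) $f\in K[x,y]$ of degree $d$, the $K$-rank $L_K(f)$ is the smallest $r$ for which there exist $\lambda_j,\alpha_j,\beta_j\in K$ with $f(x,y)=\sum_{j=1}^r\lambda_j(\alpha_jx+\beta_jy)^d$. *)

(* Defs.v *)
From HB Require Import structures.
From mathcomp Require Import all_boot all_order all_algebra.
From mathcomp Require Import reals complex mpoly.

Set Implicit Arguments.
Unset Strict Implicit.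
Unset Printing Implicit Defensive.

Import GRing.Theory.
Local Open Scope ring_scope.

(* A field is bundled as a type here, so "coefficients in K" is part of the
   typing: the form and the lambda_j, alpha_j, beta_j all live over K. *)
Definition is_power_sum (K : fieldType) (d : nat) (f : {mpoly K[2]})
    (r : nat) : Prop :=
  exists lambda alpha beta : 'I_r -> K,
    f = \sum_(j < r)
          lambda j *: (alpha j *: 'X_ord0 + beta j *: 'X_ord_max) ^+ d.

(* The degree d is an argument because a polynomial does not determine the
   degree of the form it is viewed as when it is 0. *)
Definition is_rank (K : fieldType) (d : nat) (f : {mpoly K[2]})
    (r : nat) : Prop :=
  is_power_sum d f r /\ forall s : nat, is_power_sum d f s -> (r <= s)%N.

Definition proportional (K : fieldType) (l m : {mpoly K[2]}) : Prop :=
  exists2 c : K, c != 0 & l = c *: m.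

(* Main.v *)
(* Lower bound: after a linear change of variables [f = x^(d-2) q(x, y)], with the
   coefficient of [y^2] in [q] nonzero.  So for [f = \sum_j la_j (al_j x + be_j y)^d]
   the moments [M_k = \sum_j la_j al_j^(d-k) be_j^k] satisfy [M_2 <> 0] and
   [M_k = 0] for [k > 2].  If there were at most [d - 2] summands, the form
   [y^2 x^e \prod_(be_j <> 0) (be_j x - al_j y)] of degree [d] would vanish at all
   [(al_j, be_j)]; pairing it with the moments gives [\prod be_j * M_2 = 0].

   Upper bound: since [l0] is a combination of [l1] and [l2], [f] is a multiple
   of [x^d - x^(d-2) y^2] with [x = l0].  Choose [d - 1] distinct nodes [u_j] with
   [\sum_j u_j = 0] and prescribed [\sum_j u_j^2]; weights solving the Vandermonde
   system for the first [d - 1] moments [\sum_j la_j u_j^i] then have the correct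
   two further moments, by the linear recurrence with characteristic polynomial
   [\prod_j ('X - u_j)]. *)
Require Import Defs.
From HB Require Import structures.
From mathcomp Require Import all_boot all_order all_algebra.
From mathcomp Require Import reals complex mpoly.
From mathcomp Require Import ring.

Set Implicit Arguments.
Unset Strict Implicit.
Unset Printing Implicit Defensive.

Import GRing.Theory Num.Theory.
Local Open Scope ring_scope.

(** * Moments of too few nodes *)

(* The polynomial [P] is used with the ratios [al j / be j], whose junk value [0]
   for [be j = 0] is harmless because of the factor [be j ^+ 2]. *)
Lemma moment2_eq0 (K : fieldType) (d s : nat) (la al be : 'I_s -> K) :
    (s.+2 <= d)%N ->
    (forall k, (2 < k <= d)%N -> \sum_j la j * al j ^+ (d - k) * be j ^+ k = 0) ->
  \sum_j la j * al j ^+ (d - 2) * be j ^+ 2 = 0.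
Proof.
case: d => [|[|m]] //; rewrite !ltnS => le_sm M0; rewrite subn2 /=.
(* With [d] now [m.+2], the factor ['X^(m - s)] pads the degree to exactly [m], so that the second
   moment will be paired with the leading coefficient 1. *)
pose P := (\prod_(j < s) ('X - (al j / be j)%:P)) * 'X^(m - s).
have Pmonic : P \is monic by rewrite monicMl ?monicXn ?monic_prod_XsubC.
have szP : size P = m.+1.
  rewrite size_monicM ?monic_prod_XsubC ?monic_neq0 ?monicXn //.
  by rewrite size_polyXn size_prod_XsubC [index_enum _]unlock -enumT size_enum_ord
             addSn /= addnS subnKC.
have Pm : P`_m = 1 by move/monicP: Pmonic; rewrite lead_coefE szP.
(* Up to the factor [la j], this evaluates at [(al j, be j)] the homogenization of [P] in degree
   [m], times the square of the second variable. *)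
have Pj j : \sum_(i < m.+1) P`_i * (la j * al j ^+ i * be j ^+ (m.+2 - i)) = 0.
  have [be0|be_neq0] := eqVneq (be j) 0.
    apply: big1 => i _.
    by rewrite be0 expr0n subn_eq0 ltn_geF ?mulr0 // ltnS ltnW.
  have : P.[al j / be j] = 0.
    by rewrite hornerM horner_prod (bigD1 j) //= hornerXsubC subrr !mul0r.
  rewrite horner_coef szP => /(congr1 (fun z => la j * be j ^+ m.+2 * z)).
  rewrite mulr0 mulr_sumr; apply: etrans; apply: eq_bigr => i _.
  rewrite -{2}(@subnK i m.+2); last by rewrite ltnW // ltnS ltnW.
  rewrite expr_div_n exprD; set b := be j ^+ (_ - _).
  by field; rewrite expf_eq0 (negbTE be_neq0) andbF.
have : \sum_j \sum_(i < m.+1) P`_i * (la j * al j ^+ i * be j ^+ (m.+2 - i)) = 0.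
  exact: big1.
(* The coefficient of [P] of degree [i] now multiplies the moment of index [m.+2 - i], which exceeds
   2 except for [i = m]. *)
rewrite exchange_big big_ord_recr /= big1 => [|i _]; last first.
  have le_im : (i <= m.+2)%N by exact/ltnW/ltnW/ltnW/ltn_ord.
  have := M0 (m.+2 - i)%N; rewrite subKn // -mulr_sumr => -> //; first by rewrite mulr0.
  by rewrite leq_subr andbT ltn_subRL addn2 !ltnS ltn_ord.
by rewrite add0r Pm -[X in (X - m)%N]add2n addnK; under eq_bigr do rewrite mul1r.
Qed.

(** * Nodes and weights for the upper bound *)

Lemma moments_prescribed (K : fieldType) (n : nat) (u : 'I_n -> K)
    (b : 'I_n -> K) : injective u ->
  exists la : 'I_n -> K, forall i : 'I_n, \sum_j la j * u j ^+ i = b i.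
Proof.
move=> u_inj; pose V := Vandermonde n (\row_j u j).
have Vunit : V \in unitmx.
  rewrite unitmxE det_Vandermonde unitfE.
  apply/prodf_neq0 => i _; apply/prodf_neq0 => j ij; rewrite !mxE subr_eq0.
  by apply: contraTneq ij => /u_inj ->; rewrite ltnn.
exists (fun j => (invmx V *m \col_i b i) j 0) => i.
have /colP/(_ i) := mulKVmx Vunit (\col_i b i); rewrite [in RHS]mxE => <-.
by rewrite mxE; apply: eq_bigr => j _; rewrite !mxE mulrC.
Qed.

Lemma coef_prod_XsubC_size (R : comNzRingType) (s : seq R) :
  (\prod_(x <- s) ('X - x%:P))`_(size s) = 1.
Proof.
have /monicP := monic_prod_XsubC s xpredT id.
by rewrite lead_coefE size_prod_XsubC.
Qed.

(* Multiplying by ['X] and ['X^2] makes the indices of the second and third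
   coefficients from the top correct for short [s] as well. *)
Lemma coef_prod_XsubC_e1 (R : comNzRingType) (s : seq R) :
  (\prod_(x <- s) ('X - x%:P) * 'X)`_(size s) = - \sum_(x <- s) x.
Proof.
elim: s => [|x s IHs]; first by rewrite !big_nil mul1r coefX oppr0.
rewrite !big_cons -mulrA mulrBl coefB coefXM coefCM /= IHs coefMX /=.
by rewrite coef_prod_XsubC_size mulr1 opprD addrC.
Qed.

Lemma coef_prod_XsubC_e2 (R : comNzRingType) (s : seq R) :
  (\prod_(x <- s) ('X - x%:P) * 'X^2)`_(size s) *+ 2 =
  (\sum_(x <- s) x) ^+ 2 - \sum_(x <- s) x ^+ 2.
Proof.
elim: s => [|x s IHs]; first by rewrite !big_nil mul1r coefXn expr0n subrr mul0rn.
rewrite !big_cons -mulrA mulrBl coefB coefXM coefCM /= mulrnBl IHs.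
rewrite expr2 mulrA coefMX /= coef_prod_XsubC_e1.
by ring.
Qed.

(** An arithmetic progression symmetric about 0 has sum 0 and a nonzero sum of squares; scaling by a
    square root then adjusts the latter to [c]. *)
Lemma centered_nodes (K : numClosedFieldType) (n : nat) (c : K) :
    (1 < n)%N -> c != 0 ->
  exists u : 'I_n -> K,
    [/\ injective u, \sum_j u j = 0 & \sum_j u j ^+ 2 = c].
Proof.
case: n => // n n_gt0 c_neq0; pose v (j : 'I_n.+1) : K := j%:R *+ 2 - n%:R.
have v_rev j : v (rev_ord j) = - v j.
  have : (rev_ord j + j = n)%N by rewrite /= subSS subnK // -ltnS.
  by move=> /(congr1 (fun k => k%:R : K)); rewrite natrD /v => <-; ring.
have sum_v : \sum_j v j = 0.
  apply/eqP; have /= <- := mulrn_eq0 (\sum_j v j) 2; rewrite mulr2n.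
  rewrite {1}(reindex_inj rev_ord_inj) -big_split big1 //= => j _.
  by rewrite v_rev addNr.
pose S := \sum_j v j ^+ 2.
have S_neq0 : S != 0.
  apply: contraTneq n_gt0 => /eqP.
  rewrite psumr_eq0; last first.
    move=> j _; apply: real_exprn_even_ge0 => //.
    by rewrite realB ?realn // -mulr_natr -natrM realn.
  (* If [S] vanished, so would [v ord0], which is [- n%:R]. *)
  move=> /allP/(_ ord0); rewrite mem_index_enum expf_eq0 /= => /(_ isT).
  by rewrite /v mul0rn sub0r oppr_eq0 pnatr_eq0 => /eqP ->.
pose sg := sqrtC (c / S).
have sg_neq0 : sg != 0 by rewrite sqrtC_eq0 mulf_neq0 ?invr_eq0.
exists (fun j => sg * v j); split.
- move=> i j /(mulfI sg_neq0) /addIr /eqP.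
  by rewrite eqrMn2r eqr_nat => /eqP/val_inj.
- by rewrite -mulr_sumr sum_v mulr0.
- under eq_bigr do rewrite exprMn.
  by rewrite -mulr_sumr sqrtCK divfK.
Qed.

(** When [q] vanishes at all nodes, this becomes a linear recurrence for the moments. *)
Lemma sum_horner_moments (K : comNzRingType) (n m : nat) (la u : 'I_n -> K)
    (q : {poly K}) : (size q <= m)%N ->
  \sum_j la j * q.[u j] = \sum_(i < m) q`_i * \sum_j la j * u j ^+ i.
Proof.
move=> szq; under eq_bigr do rewrite (horner_coef_wide _ szq) mulr_sumr.
rewrite exchange_big; apply: eq_bigr => i _; rewrite mulr_sumr.
by apply: eq_bigr => j _; rewrite mulrCA.
Qed.

(** With [C] the binomial coefficient, nodes of sum 0 and square sum [- (C *+ 2)] make 1, 0, [C] the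
    top coefficients of the node polynomial. The recurrence then turns the moments 0, ..., 0,
    [- C^-1] into the next two, 0 and 1. *)
Lemma centered_moments (K : numClosedFieldType) (m : nat) : (0 < m)%N ->
  exists la u : 'I_m.+1 -> K,
    [/\ forall i, (i < m)%N -> \sum_j la j * u j ^+ i = 0,
        \sum_j la j * u j ^+ m = - 'C(m.+2, 2)%:R^-1,
        \sum_j la j * u j ^+ m.+1 = 0 &
        \sum_j la j * u j ^+ m.+2 = 1].
Proof.
move=> m_gt0; pose C : K := 'C(m.+2, 2)%:R.
have C_neq0 : C != 0 by rewrite pnatr_eq0 -lt0n bin_gt0.
have [||u [u_inj sum_u sum_u2]] := @centered_nodes K m.+1 (- (C *+ 2)).
- by rewrite ltnS.
- by rewrite oppr_eq0 mulrn_eq0.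
pose b (i : 'I_m.+1) : K := if (i < m)%N then 0 else - C^-1.
have [la laE] := moments_prescribed b u_inj.
pose N i := \sum_j la j * u j ^+ i.
have N_lt i : (i < m)%N -> N i = 0.
  by move=> im; rewrite /N (laE (Ordinal (ltnW im : (i < m.+1)%N))) /b /= im.
have N_m : N m = - C^-1 by rewrite /N (laE ord_max) /b /= ltnn.
pose s := [seq u j | j <- index_enum 'I_m.+1].
have szs : size s = m.+1 by rewrite size_map [index_enum _]unlock -enumT size_enum_ord.
pose p := \prod_(x <- s) ('X - x%:P).
have pu j : p.[u j] = 0.
  by rewrite /p big_map horner_prod (bigD1 j) //= hornerXsubC subrr mul0r.
have p_top : p`_m.+1 = 1 by rewrite -szs coef_prod_XsubC_size.
have p_e1 : p`_m = 0.
  have := coef_prod_XsubC_e1 s.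
  by rewrite szs coefMX /= -/p big_map sum_u oppr0.
have pX_e2 : (p * 'X)`_m = C.
  have := coef_prod_XsubC_e2 s.
  rewrite szs expr2 mulrA coefMX /= -/p !big_map sum_u sum_u2 expr0n sub0r opprK.
  by move/eqP; rewrite eqrMn2r => /eqP.
have szp : size p = m.+2 by rewrite size_prod_XsubC szs.
have N_m1 : N m.+1 = 0.
  have := sum_horner_moments la u (eq_leq szp).
  rewrite big1 => [|j _]; last by rewrite pu mulr0.
  rewrite 2!big_ord_recr big1 /= => [|i _]; last by rewrite -/(N i) N_lt ?mulr0.
  by rewrite p_top p_e1 mul0r mul1r !add0r => /esym.
(* The multiple [p * 'X] shifts the recurrence by one and gives [N m.+2 + C * N m = 0]. *)
have N_m2 : N m.+2 = 1.
  have szpX : (size (p * 'X)%R <= m.+3)%N.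
    by rewrite size_mulX -?size_poly_eq0 szp.
  have := sum_horner_moments la u szpX.
  rewrite big1 => [|j _]; last by rewrite hornerM pu mul0r mulr0.
  rewrite 3!big_ord_recr big1 /= => [|i _]; last by rewrite -/(N i) N_lt ?mulr0.
  rewrite -/(N m) -/(N m.+1) -/(N m.+2) N_m N_m1 pX_e2 mulr0 !coefMX /= p_top.
  rewrite mulrN divff // addr0 mul1r add0r addrC => /esym/eqP.
  by rewrite subr_eq0 => /eqP.
by exists la, u; split.
Qed.

(** In the binomial expansion only the three highest powers of [x] meet possibly nonzero moments;
    the value [- C^-1] cancels the binomial coefficient at [y ^+ 2]. *)
Lemma power_sum_xd_xd2y2 (K : numClosedFieldType) (m : nat) : (0 < m)%N ->
  exists la u : 'I_m.+1 -> K, forall (A : comAlgType K) (x y : A),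
    \sum_j la j *: (u j *: x + y) ^+ m.+2 = x ^+ m.+2 - x ^+ m * y ^+ 2.
Proof.
move=> m_gt0; have [la [u [N_lt N_m N_m1 N_m2]]] := centered_moments K m_gt0.
exists la, u => A x y.
transitivity (\sum_(i < m.+3) ((\sum_j la j * u j ^+ (m.+2 - i)) *: 
    (x ^+ (m.+2 - i) * y ^+ i)) *+ 'C(m.+2, i)).
  under eq_bigr do rewrite exprDn scaler_sumr.
  rewrite exchange_big; apply: eq_bigr => i _ /=.
  rewrite scaler_suml -sumrMnl; apply: eq_bigr => j _.
  by rewrite exprZn -scalerAl scalerMnr scalerA scalerMnr.
rewrite 3!big_ord_recl [X in _ + (_ + (_ + X))]big1 => [|i _] /=.
  rewrite /bump !subSS !subn0 N_m2 N_m1 N_m scale0r mul0rn add0r addr0 scale1r expr0.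
  rewrite mulr1 bin0 mulr1n; congr (_ + _).
  by rewrite scaleNr mulNrn -scaler_nat scalerA divff ?scale1r // pnatr_eq0 -lt0n bin_gt0.
by rewrite /bump !subSS N_lt ?scale0r ?mul0rn // ltn_subrL m_gt0.
Qed.

(** * Binary linear forms *)

Lemma dhomog1_coef (R : nzRingType) (l : {mpoly R[2]}) : l \is 1.-homog ->
  l = l@_U_(ord0) *: 'X_ord0 + l@_U_(ord_max) *: 'X_ord_max.
Proof.
move=> hl; apply/mpolyP => m; rewrite mcoeffD !mcoeffZ !mcoeffX.
have [/eqP/mdeg1P[i /eqP ->]|m_neq1] := eqVneq (mdeg m) 1%N; last first.
  rewrite (dhomog_nemf_coeff hl m_neq1).
  rewrite !(negbTE (contra_neq _ m_neq1)) ?mulr0 ?addr0 // => <-; exact: mdeg1.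
rewrite !eq_mnm1; have [->|] := eqVneq i ord0.
  by rewrite mulr1 mulr0 addr0.
case: i => [[|[|i]] //= lti] _; rewrite mulr0 add0r (_ : Ordinal lti = ord_max) ?mulr1 //.
exact: val_inj.
Qed.

Lemma nonproportional_det (K : fieldType) (l l' : {mpoly K[2]}) (a b a' b' : K) :
    l = a *: 'X_ord0 + b *: 'X_ord_max ->
    l' = a' *: 'X_ord0 + b' *: 'X_ord_max ->
    l != 0 -> l' != 0 -> ~ proportional l l' ->
  a * b' - a' * b != 0.
Proof.
move=> lE l'E l_neq0 l'_neq0 nprop; apply/eqP => /eqP; rewrite subr_eq0 => /eqP det0.
suff [c lc] : exists c, l = c *: l'.
  apply: nprop; exists c => //.
  by apply: contraNneq l_neq0 => c0; rewrite lc c0 scale0r.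
(* The factor is read off from a nonzero coefficient of [l']. *)
rewrite lE l'E; have [a'0|a'_neq0] := eqVneq a' 0.
  have b'_neq0 : b' != 0.
    by apply: contraNneq l'_neq0 => b'0; rewrite l'E a'0 b'0 !scale0r addr0.
  have a0 : a = 0 by apply: (mulIf b'_neq0); rewrite det0 a'0 !mul0r.
  by exists (b / b'); rewrite a0 a'0 !scale0r !add0r scalerA divfK.
exists (a / a'); rewrite scalerDr !scalerA divfK //.
by congr (_ + _ *: _); rewrite mulrAC det0 mulrAC divff // mul1r.
Qed.

(** * Lower bound by dehomogenization *)

Lemma coef_linear_exp (R : comNzRingType) (d k : nat) (a b : R) : (k <= d)%N ->
  ((a%:P + b%:P * 'X) ^+ d)`_k = a ^+ (d - k) * b ^+ k *+ 'C(d, k).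
Proof.
move=> le_kd; rewrite exprDn.
under eq_bigr do rewrite exprMn -!rmorphXn /= mulrA -rmorphM mul_polyC scalerMnl.
rewrite -(poly_def d.+1 (fun i => a ^+ (d - i) * b ^+ i *+ 'C(d, i))).
by rewrite coef_poly ltnS le_kd.
Qed.

Lemma power_sum_coef (R : comNzRingType) (d s k : nat) (la al be : 'I_s -> R) :
    (k <= d)%N ->
  (\sum_j (la j)%:P * ((al j)%:P + (be j)%:P * 'X) ^+ d)`_k =
  (\sum_j la j * al j ^+ (d - k) * be j ^+ k) *+ 'C(d, k).
Proof.
move=> le_kd; rewrite coef_sum -sumrMnl; apply: eq_bigr => j _.
by rewrite coefCM coef_linear_exp // -mulrnAr mulrA mulrnAr.
Qed.

Local Notation lf a b := (a *: 'X_ord0 + b *: 'X_ord_max).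

(* The substitution sending [l0] to [1] and [l1] to ['X] dehomogenizes the form
   to a quadratic polynomial with nonzero coefficient of ['X^2]. *)
Lemma power_sum_lower_bound (K : numFieldType) (d s : nat)
    (a0 b0 a1 b1 a2 b2 : K) : (2 <= d)%N ->
    a0 * b1 - a1 * b0 != 0 -> a0 * b2 - a2 * b0 != 0 ->
    is_power_sum d (lf a0 b0 ^+ (d - 2) * lf a1 b1 * lf a2 b2) s ->
  (d - 1 <= s)%N.
Proof.
move=> d_ge2; set D := a0 * b1 - a1 * b0; set E := a0 * b2 - a2 * b0.
move=> D_neq0 E_neq0 [la [al [be sumE]]].
rewrite leqNgt; apply/negP => s_lt.
(* By Cramer's rule, [P0] and [P1] solve [l0 = 1], [l1 = 'X]. *)
pose P0 : {poly K} := (b1 / D)%:P + (- b0 / D)%:P * 'X.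
pose P1 : {poly K} := (- a1 / D)%:P + (a0 / D)%:P * 'X.
pose phi (p : {mpoly K[2]}) : {poly K} :=
  mmap polyC (fun i => if i == ord0 then P0 else P1) p.
have phi_lf a b : phi (lf a b) =
    ((a * b1 - a1 * b) / D)%:P + ((a0 * b - a * b0) / D)%:P * 'X.
  rewrite /phi mmapD !mmapZ !mmapX !mmap1U /= /P0 /P1.
  rewrite !mulrDr !mulrA -!polyCM addrACA -mulrDl -!polyCD.
  by congr (_%:P + _%:P * _); ring.
pose A j := (al j * b1 - a1 * be j) / D.
pose B j := (a0 * be j - al j * b0) / D.
have phiM p q : phi (p * q) = phi p * phi q by exact: rmorphM.
have phiX p k : phi (p ^+ k) = phi p ^+ k by exact: rmorphXn.
have := congr1 phi sumE; rewrite [phi (\sum_j _)]raddf_sum /=.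
under eq_bigr do rewrite mmapZ [mmap _ _ _]phiX phi_lf -/(A _) -/(B _).
have -> : phi (lf a0 b0 ^+ (d - 2) * lf a1 b1 * lf a2 b2) =
    'X * (((a2 * b1 - a1 * b2) / D)%:P + (E / D)%:P * 'X).
  rewrite !phiM phiX !phi_lf -/D divff // subrr mul0r mul0r addr0.
  by rewrite expr1n mul1r subrr mul0r add0r mul1r.
move=> phi_sum.
have coef_sumE k : (k <= d)%N -> 
    (\sum_j la j * A j ^+ (d - k) * B j ^+ k) *+ 'C(d, k) = (E / D) *+ (k == 2%N)
      + ((a2 * b1 - a1 * b2) / D) *+ (k == 1%N).
  move=> le_kd; rewrite -power_sum_coef // -phi_sum mulrDr mulrCA -expr2 mulrC.
  by rewrite coefD !coefCM coefX coefXn !mulr_natr addrC.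
have bin_neq0 k : (k <= d)%N -> 'C(d, k)%:R != 0 :> K.
  by move=> le_kd; rewrite pnatr_eq0 -lt0n bin_gt0.
have : \sum_j la j * A j ^+ (d - 2) * B j ^+ 2 = 0.
  apply: moment2_eq0 => [|k /andP[k_gt2 le_kd]].
    by rewrite ltn_subRL add1n in s_lt.
  have := coef_sumE k le_kd.
  rewrite (gtn_eqF k_gt2) (gtn_eqF (ltnW k_gt2)) !mulr0n addr0 -mulr_natr => /eqP.
  by rewrite mulf_eq0 (negbTE (bin_neq0 _ _)) // orbF => /eqP.
move=> m2; have := coef_sumE 2%N d_ge2; rewrite m2 mul0rn /= addr0 => /esym/eqP.
by rewrite mulf_eq0 invr_eq0 (negbTE E_neq0) (negbTE D_neq0).
Qed.

(** * Upper bound and conclusion *)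

(* With [l0 = a *: l1 + b *: l2] and [y = a *: l1 - b *: l2], the product
   [4ab * l1 * l2] is [l0 ^+ 2 - y ^+ 2]. *)
Lemma power_sum_upper_bound (K : numClosedFieldType) (d : nat)
    (a0 b0 a1 b1 a2 b2 : K) : (3 <= d)%N ->
    a0 * b1 - a1 * b0 != 0 -> a0 * b2 - a2 * b0 != 0 ->
    a1 * b2 - a2 * b1 != 0 ->
  is_power_sum d (lf a0 b0 ^+ (d - 2) * lf a1 b1 * lf a2 b2) (d - 1).
Proof.
case: d => [|[|m]] //; rewrite !ltnS subn2 subn1 /= => m_gt0.
set D01 := _ - _; set D02 := _ - _; set D12 := _ - _ => n01 n02 n12.
(* Cramer's rule for [l0 = a *: l1 + b *: l2]; both are nonzero because [l0] is proportional to
   neither [l2] nor [l1]. *)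
pose a := D02 / D12; pose b := - D01 / D12.
have [la [u sumE]] := power_sum_xd_xd2y2 K m_gt0.
pose c := 4 * a * b.
have c_neq0 : c != 0.
  by rewrite !mulf_neq0 ?invr_eq0 ?oppr_eq0 ?pnatr_eq0.
pose ya := a * a1 - b * a2; pose yb := a * b1 - b * b2.
exists (fun j => la j / c), (fun j => u j * a0 + ya), (fun j => u j * b0 + yb).
have a0E : a0 = a * a1 + b * a2 by rewrite /a /b /D01 /D02 /D12; field.
have b0E : b0 = a * b1 + b * b2 by rewrite /a /b /D01 /D02 /D12; field.
have lfE (t p q p' q' : K) : lf (t * p + p') (t * q + q') = 
    t *: lf p q + lf p' q' :> {mpoly K[2]}.
  by rewrite !scalerDl !scalerDr !scalerA addrACA.
transitivity (c^-1 *: (\sum_j la j *: (u j *: lf a0 b0 + lf ya yb) ^+ m.+2)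
    : {mpoly K[2]}).
  set l1 := lf a1 b1; set l2 := lf a2 b2.
  have -> : lf ya yb = a *: l1 - b *: l2.
    by rewrite /ya /yb !scalerBl !scalerDr !scalerA opprD addrACA.
  have l0E : lf a0 b0 = a *: l1 + b *: l2.
    by rewrite [in LHS]a0E [in LHS]b0E !scalerDl !scalerDr !scalerA addrACA.
  rewrite sumE l0E -(addn2 m) exprD -mulrBr -mulrA scalerAr; congr (_ * _).
  have -> v w : (v + w) ^+ 2 - (v - w) ^+ 2 = (v * w) *+ 4 :> {mpoly K[2]} by ring.
  rewrite -scalerAl -scalerAr -scaler_nat !scalerA.
  by rewrite -2!mulrA [4 * _]mulrA mulVf ?scale1r.
rewrite scaler_sumr; apply: eq_bigr => j _.
by rewrite (lfE (u j)) scalerA [la j / c]mulrC.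
Qed.

Theorem corollary3p2 (R : realType) (d : nat) (f l0 l1 l2 : {mpoly R[i][2]})
    (hd : (3 <= d)%N)
    (hl0 : l0 \is 1.-homog) (hl1 : l1 \is 1.-homog) (hl2 : l2 \is 1.-homog)
    (l0_neq0 : l0 != 0) (l1_neq0 : l1 != 0) (l2_neq0 : l2 != 0)
    (h01 : ~ proportional l0 l1) (h02 : ~ proportional l0 l2)
    (h12 : ~ proportional l1 l2)
    (hf : f = l0 ^+ (d - 2) * l1 * l2) :
  is_rank d f (d - 1).
Proof.
have e0 := dhomog1_coef hl0; have e1 := dhomog1_coef hl1.
have e2 := dhomog1_coef hl2.
have n01 := nonproportional_det e0 e1 l0_neq0 l1_neq0 h01.
have n02 := nonproportional_det e0 e2 l0_neq0 l2_neq0 h02.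
have n12 := nonproportional_det e1 e2 l1_neq0 l2_neq0 h12.
rewrite hf e0 e1 e2; split=> [|s].
  exact: power_sum_upper_bound.
by apply: power_sum_lower_bound => //; apply: ltnW.
Qed.
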